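(* Let $m,t\ge1$ be integers. The $2^m\times2^{(t+1)m}$ frame $\Phi$ with rows indexed by $x\in\mathbb F_{2^m}$, columns indexed by $\alpha=(\alpha_0,\dots,\alpha_t)\in\mathbb F_{2^m}^{t+1}$, and entries $$\Phi_{x\alpha}=\frac1{\sqrt{2^m}}(-1)^{\mathrm{Tr}\left[\alpha_0x+\sum_{i=1}^t\alpha_ix^{2^i+1}\right]}$$ is unit norm and tight, i.e., $\|\Phi\|_2^2=2^{tm}$, with worst-case coherence $\mu\le\frac1{\sqrt{2^{m-2t-1}}}$ and average coherence $\nu\le\frac{\mu}{\sqrt{2^m}}$.
   Context: $\mathrm{Tr}:\mathbb F_{2^m}\to\mathbb F_2$ is the trace map $\mathrm{Tr}(z)=\sum_{i=0}^{m-1}z^{2^i}$. Unit norm means all columns have unit norm; tight means the rows are pairwise orthogonal with equal norms; $\|\Phi\|_2$ is the spectral norm. For a matrix with $N$ unit-norm columns $\varphi_1,\dots,\varphi_N$, the worst-case coherence is $\mu:=\max_{i\ne j}|\langle\varphi_i,\varphi_j\rangle|$ and the average coherence is $\nu:=\max_i\left|\frac1{N-1}\sum_{j\ne i}\langle\varphi_i,\varphi_j\rangle\right|$. *)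

(* Defs.v *)
From mathcomp Require Import all_boot all_order all_algebra all_field.
From mathcomp Require Import all_classical all_reals.

Set Implicit Arguments.
Unset Strict Implicit.
Unset Printing Implicit Defensive.

Import Order.TTheory GRing.Theory Num.Theory.
Local Open Scope ring_scope.

(* All frames below are real, so the inner product is bilinear and the spectral
   norm over the reals coincides with the one over the complex numbers. *)

Definition inner (R : realType) (n : nat) (u v : 'cV[R]_n) : R :=
  (u^T *m v) 0 0.

Definition norm2 (R : realType) (n : nat) (u : 'cV[R]_n) : R :=
  Num.sqrt (inner u u).

Definition spectral_norm (R : realType) (n N : nat) (A : 'M[R]_(n, N)) : R :=
  sup [set norm2 (A *m v) | v in [set v : 'cV[R]_N | norm2 v <= 1]]%classic.

Definition unit_norm (R : realType) (n N : nat) (A : 'M[R]_(n, N)) : Prop :=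
  forall j : 'I_N, norm2 (col j A) = 1.

Definition tight (R : realType) (n N : nat) (A : 'M[R]_(n, N)) : Prop :=
  (forall i k : 'I_n, i != k -> inner (row i A)^T (row k A)^T = 0) /\
  (forall i k : 'I_n, norm2 (row i A)^T = norm2 (row k A)^T).

(* In both coherences the default value 0 of the iterated maximum is harmless,
   since the maximum is taken over nonnegative numbers. *)

Definition worst_case_coherence (R : realType) (n N : nat)
    (A : 'M[R]_(n, N)) : R :=
  \big[Num.max/0]_(p : 'I_N * 'I_N | p.1 != p.2)
    `|inner (col p.1 A) (col p.2 A)|.

Definition average_coherence (R : realType) (n N : nat)
    (A : 'M[R]_(n, N)) : R :=
  \big[Num.max/0]_(i < N)
    `|(N.-1)%:R^-1 * \sum_(j < N | j != i) inner (col i A) (col j A)|.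

Definition field_trace (F : finFieldType) (m : nat) (z : F) : F :=
  \sum_(i < m) z ^+ (2 ^ i).

(* When F has 2 ^ m elements, the trace lies in the prime subfield {0, 1}, which
   is what makes trace_bit the identification of Tr z with an exponent. *)
Lemma field_trace01 (F : finFieldType) (m : nat) (z : F) :
  (0 < m)%N -> #|F| = (2 ^ m)%N ->
  field_trace m z = 0 \/ field_trace m z = 1.
Proof.
move=> m0 cF.
have F2 : 2%N \in [pchar F] by exact: (card_finPcharP cF).
have sqE : field_trace m z ^+ 2 = field_trace m z.
  rewrite /field_trace -(pFrobenius_autE F2) rmorph_sum /=.
  under eq_bigr => i _ do rewrite pFrobenius_autE -exprM -expnSr.
  case: m m0 cF => // m _ cF.
  rewrite big_ord_recr big_ord_recl /= -cF expf_card addrC expn0 expr1.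
  by congr (_ + _); apply: eq_bigr.
have /eqP : field_trace m z * (field_trace m z - 1) = 0.
  by rewrite mulrBr mulr1 -expr2 sqE subrr.
by rewrite mulf_eq0 subr_eq0 => /orP[] /eqP ->; [left|right].
Qed.

Definition trace_bit (F : finFieldType) (m : nat) (z : F) : bool :=
  field_trace m z != 0.

(* Matrices are indexed by ordinals, so the index sets F and F^(t+1) are
   enumerated by enum_val. *)
Definition DG_frame (R : realType) (F : finFieldType) (m t : nat) :
    'M[R]_(#|F|, #|{ffun 'I_t.+1 -> F}|) :=
  \matrix_(r, c)
    let x : F := enum_val r in
    let alpha : {ffun 'I_t.+1 -> F} := enum_val c in
    (Num.sqrt (2 ^+ m))^-1 *
    (-1) ^+ trace_bit m
      (alpha ord0 * x + \sum_(i < t.+1 | (0 < i)%N) alpha i * x ^+ (2 ^ i + 1)).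

(* Main.v *)
Require Import Defs.
From mathcomp Require Import all_boot all_order all_algebra all_field.
From mathcomp Require Import all_classical all_reals.
From mathcomp Require Import ring lra zify.

Set Implicit Arguments.
Unset Strict Implicit.
Unset Printing Implicit Defensive.

Import Order.TTheory GRing.Theory Num.Theory.
Local Open Scope ring_scope.

(** Everything rests on the additive character chi z = (-1)^Tr(z) of F and on
    orthogonality: a character sum vanishes as soon as some translation
    multiplies every term by a constant other than 1 ([sum_shift_eigen0]).

    Rows. Summing over the columns alpha, the product of the entries in rows x
    and y is a character of F^(t+1) in alpha, and the coordinate alpha_0 already
    sees it as alpha_0 |-> chi (alpha_0 (x + y)), which is nontrivial if x and y
    differ. Hence the rows are orthogonal, Phi Phi^T = 2^(tm) I ([DG_gram]).
    Tightness and the value of the spectral norm are consequences of this matrix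
    identity alone.

    Columns. The characteristic is 2, so the inner product of the columns alpha
    and beta is 2^(-m) S, where S is the sum over x of chi (Q x) and Q is the
    exponent of the column a = alpha + beta, which is nonzero if alpha and beta
    differ. If a_i = 0 for all i > 0, then Q is linear and S = 0. Otherwise Q is
    quadratic and Weil's squaring trick applies: S^2 is a sum over pairs (x, x + y),
    and the polarization chi (Q (x + y)) = chi (Q x) chi (Q y) chi (L(x) y^(2^t))
    turns the sum over y into an orthogonality relation which retains only the x
    with L(x) = 0. The polarization of the monomial a_i x^(2^i+1) has the two
    terms a_i x^(2^i) y and a_i x y^(2^i); since Tr is Frobenius invariant, both
    can be given the same power y^(2^t), and L is then a nonzero polynomial of
    degree at most 2^(2t). Therefore S^2 <= 2^m 2^(2t) ([DG_sum_sqr]), so that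
    mu^2 <= 2^(2t - m), which is stronger than the claim by a factor 2.

    Average coherence. Only the row x = 0 has a nonzero sum, so the inner products
    of one column with all the others add up to exactly 2^(tm) - 1, and nu is the
    number q = (2^(tm) - 1) / (N - 1), where N = 2^((t+1)m). Clearly q <= 2^(-m),
    and q <= mu^2 is the Welch bound: by tightness the squares of the inner products of
    one column with the others add up to 2^(tm) - 1 as well ([welch_bound]).
    Multiplying the two bounds gives nu^2 <= mu^2 / 2^m. *)

(** * The quadratic trace character *)

(** The translation argument behind orthogonality of characters. It is phrased
    with a bijection h of a finite type because it serves both for F and for
    the coefficient vectors in F^(t+1). *)
Lemma sum_shift_eigen0 (R : idomainType) (T : finType) (h : T -> T)
    (psi : T -> R) (c : R) :
  injective h -> (forall x, psi (h x) = c * psi x) -> c != 1 ->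
  \sum_x psi x = 0.
Proof.
move=> h_inj psi_h c1.
have /eqP : \sum_x psi x = c * \sum_x psi x.
  rewrite [LHS](reindex_inj h_inj) mulr_sumr.
  by apply: eq_bigr => x _; exact: psi_h.
rewrite -subr_eq0 -{1}[\sum_x psi x]mul1r -mulrBl mulf_eq0 subr_eq0 eq_sym.
by rewrite (negPf c1) => /eqP.
Qed.

Section TraceCharacter.

Context (R : realType) (F : finFieldType) (m : nat).
Hypotheses (m_gt0 : (0 < m)%N) (cardF : #|F| = (2 ^ m)%N).

Let tr : F -> F := field_trace m.

Lemma pchar2_field : 2%N \in [pchar F].
Proof. exact: (card_finPcharP cardF). Qed.

Lemma exprD_pow2 (k : nat) (x y : F) :
  (x + y) ^+ (2 ^ k) = x ^+ (2 ^ k) + y ^+ (2 ^ k).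
Proof.
by apply: exprDn_pchar; rewrite pnatX pnatE // pchar2_field.
Qed.

Lemma field_traceD (x y : F) : tr (x + y) = tr x + tr y.
Proof.
rewrite /tr /field_trace -big_split /=.
by apply: eq_bigr => i _; exact: exprD_pow2.
Qed.

(** The trace commutes with the Frobenius map and takes its values in the prime
    field, where the Frobenius map is the identity. *)
Lemma field_trace_pow2 (k : nat) (x : F) : tr (x ^+ (2 ^ k)) = tr x.
Proof.
have trX n : tr (x ^+ (2 ^ n)) = tr x ^+ (2 ^ n).
  rewrite /tr /field_trace; elim: n => [|n IHn] //.
  rewrite expnSr (exprM (\sum_(i < m) _)) -IHn.
  rewrite -(pFrobenius_autE pchar2_field) rmorph_sum /=.
  by apply: eq_bigr => i _; rewrite pFrobenius_autE -!exprM mulnAC.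
rewrite trX; case: (field_trace01 x m_gt0 cardF); rewrite /tr => ->.
  by rewrite expr0n expn_eq0.
by rewrite expr1n.
Qed.

(** The trace is a polynomial function of degree 2^(m-1), too small for the
    polynomial to vanish on all of the 2^m elements of F. *)
Lemma field_trace_neq0 : exists x : F, tr x != 0.
Proof.
apply/existsP; apply: contraT; rewrite negb_exists => /forallP tr0.
pose P : {poly F} := \sum_(i < m) 'X^(2 ^ i).
have hornerP x : P.[x] = tr x.
  by rewrite horner_sum; apply: eq_bigr => i _; rewrite hornerXn.
have P_neq0 : P != 0.
  (* The coefficient of 'X comes from the summand i = 0 only. *)
  apply/eqP => /(congr1 (fun p : {poly F} => p`_1)).
  case: m m_gt0 @P {hornerP tr0} => // m' _ /=.
  rewrite coef0 coef_sum big_ord_recl /= coefXn eqxx big1.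
    by rewrite addr0 => /eqP; rewrite oner_eq0.
  by move=> i _; rewrite coefXn /= expnS mul2n eqn_leq leqNgt -leq_double;
     case: (2 ^ i)%N (expn_gt0 2 i).
have sizeP : (size P <= 2 ^ m)%N.
  apply/leq_sizeP => j le_mj; rewrite coef_sum big1 // => i _.
  rewrite coefXn; case: eqP => // eq_j.
  by move: le_mj; rewrite eq_j leq_exp2l // leqNgt ltn_ord.
have /(max_poly_roots P_neq0) : all (root P) (enum F).
  by apply/allP => x _; rewrite /root hornerP; move: (tr0 x); rewrite negbK.
by rewrite enum_uniq -cardE cardF => /(_ isT); rewrite ltnNge sizeP.
Qed.

Definition trace_char (z : F) : R := (-1) ^+ trace_bit m z.
Local Notation chi := trace_char.

Lemma trace_charD (x y : F) : chi (x + y) = chi x * chi y.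
Proof.
rewrite /chi /trace_bit -/tr field_traceD -/tr.
have := field_trace01 x m_gt0 cardF; have := field_trace01 y m_gt0 cardF.
rewrite -/tr; do 2![case=> ->]; rewrite ?addr0 ?add0r ?eqxx ?oner_eq0 /=.
- by rewrite !expr0 mulr1.
- by rewrite expr0 mulr1.
- by rewrite expr0 mul1r.
by rewrite (addrr_pchar2 pchar2_field) eqxx /= expr0 expr1 mulrNN mulr1.
Qed.

Lemma trace_char_sqr (x : F) : chi x * chi x = 1.
Proof. by rewrite /chi -signr_addb addbb. Qed.

Lemma trace_char0 : chi 0 = 1.
Proof. by rewrite -[0](addrr_pchar2 pchar2_field 0) trace_charD trace_char_sqr. Qed.

Lemma normr_trace_char (x : F) : `|chi x| = 1.
Proof. exact: normr_sign. Qed.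

Lemma trace_char_pow2 (k : nat) (x : F) : chi (x ^+ (2 ^ k)) = chi x.
Proof. by rewrite /chi /trace_bit -/tr field_trace_pow2. Qed.

Lemma trace_char_mul_neq1 (u : F) :
  u != 0 -> exists x, chi (u * x) != 1.
Proof.
move=> u0; have [y try] := field_trace_neq0; exists (u^-1 * y).
rewrite mulVKf // /chi /trace_bit -/tr try expr1 eq_sym -subr_eq0 opprK.
by rewrite (_ : 1 + 1 = 2%:R) // pnatr_eq0.
Qed.

(** Orthogonality for F. The power 2^k only permutes F; allowing it here spares
    the extraction of 2^t-th roots in the polarized quadratic form. *)
Lemma sum_trace_char_lin (k : nat) (u : F) :
  \sum_x chi (u * x ^+ (2 ^ k)) = (2 ^ m)%:R *+ (u == 0).
Proof.
have [->|u0] := eqVneq u 0.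
  under eq_bigr => x _ do rewrite mul0r trace_char0.
  by rewrite sumr_const cardF.
have frob_inj : injective (fun x : F => x ^+ (2 ^ k)).
  move=> x y /eqP; rewrite -subr_eq0 -{1}(oppr_pchar2 pchar2_field (y ^+ _)).
  rewrite opprK -exprD_pow2 expf_eq0 expn_gt0 /= addr_eq0.
  by rewrite (oppr_pchar2 pchar2_field) => /eqP.
rewrite -(reindex_inj frob_inj (P := predT) (F := fun x => chi (u * x))) /=.
have [x chi_ux] := trace_char_mul_neq1 u0.
apply: (sum_shift_eigen0 (h := +%R x)) chi_ux; first exact: addrI.
by move=> y; rewrite mulrDr trace_charD.
Qed.

(** * Quadratic exponential sums *)

Section QuadraticSum.

Context (t : nat) (a : 'I_t.+1 -> F).

Definition DG_exponent (x : F) : F :=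
  a ord0 * x + \sum_(i < t.+1 | (0 < i)%N) a i * x ^+ (2 ^ i + 1).

(** The linearized polynomial L whose roots in F form the radical of the bilinear
    form Tr (Q (x + y) - Q x - Q y), for Q = [DG_exponent]: this form equals
    Tr (L(x) y^(2^t)). *)
Definition radical_poly : {poly F} :=
  \sum_(i < t.+1 | (0 < i)%N)
    (a i ^+ (2 ^ t) *: 'X^(2 ^ (i + t)) +
     a i ^+ (2 ^ (t - i)) *: 'X^(2 ^ (t - i))).

(** Polarization. Under the trace, a_i x^(2^i) y may be raised to the power 2^t
    and a_i x y^(2^i) to the power 2^(t-i), which produces y^(2^t) in both. *)
Lemma trace_char_DG_exponentD (x y : F) :
  chi (DG_exponent (x + y)) =
  chi (DG_exponent x) * chi (DG_exponent y) *
  chi (radical_poly.[x] * y ^+ (2 ^ t)).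
Proof.
have chi_sum (P : pred 'I_t.+1) (f g : 'I_t.+1 -> F) :
    (forall i, P i -> chi (f i) = chi (g i)) ->
    chi (\sum_(i < t.+1 | P i) f i) = chi (\sum_(i < t.+1 | P i) g i).
  move=> fg; apply: (big_ind2 (fun u v => chi u = chi v)) => //.
  by move=> u u' v v' uu' vv'; rewrite !trace_charD uu' vv'.
set B := \sum_(i < t.+1 | (0 < i)%N) (a i * x ^+ (2 ^ i) * y + a i * x * y ^+ (2 ^ i)).
have -> : DG_exponent (x + y) = DG_exponent x + DG_exponent y + B.
  rewrite /DG_exponent /B mulrDr addrACA -[RHS]addrA; congr (_ + _).
  rewrite -!big_split /=; apply: eq_bigr => i _.
  rewrite !addn1 !exprSr exprD_pow2; ring.
rewrite !trace_charD; congr (_ * _).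
rewrite /radical_poly horner_sum mulr_suml; apply: chi_sum => i i_gt0.
rewrite !hornerE mulrDl !trace_charD; congr (_ * _).
  rewrite -[LHS](trace_char_pow2 t) !exprMn -!exprM -expnD; congr chi; ring.
have le_it : (i <= t)%N by rewrite -ltnS.
rewrite -[LHS](trace_char_pow2 (t - i)) !exprMn -!exprM -expnD.
by rewrite subnKC.
Qed.

(** The exponents 2^(i+t) and 2^(t-i) with i > 0 are pairwise distinct, so no
    cancellation affects the monomial of degree 2^(j+t). *)
Lemma radical_poly_neq0 (j : 'I_t.+1) :
  (0 < j)%N -> a j != 0 -> radical_poly != 0.
Proof.
move=> j_gt0 aj0.
apply: contra_neq aj0 => /(congr1 (fun p : {poly F} => p`_(2 ^ (j + t)))).
rewrite coef0 coef_sum (bigD1 j) //= big1 => [|i /andP[i_gt0 i_neq_j]].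
  rewrite addr0 coefD !coefZ !coefXn eqxx mulr1 eqn_exp2l //.
  have -> : (j + t == t - j)%N = false by lia.
  by rewrite mulr0 addr0 => /eqP; rewrite expf_eq0 => /andP[_ /eqP].
rewrite coefD !coefZ !coefXn !eqn_exp2l // eqn_add2r.
have -> : (j + t == t - i)%N = false by lia.
have -> : (j == i :> nat)%N = false by apply/negbTE; rewrite eq_sym.
by rewrite !mulr0 addr0.
Qed.

Lemma card_radical (j : 'I_t.+1) :
  (0 < j)%N -> a j != 0 ->
  (#|[pred x | root radical_poly x]| <= 2 ^ (2 * t))%N.
Proof.
move=> j_gt0 aj0; rewrite -ltnS cardE.
have roots : all (root radical_poly) (enum [pred x | root radical_poly x]).
  by apply/allP => x; rewrite mem_enum.
have P0 := radical_poly_neq0 j_gt0 aj0.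
apply: leq_trans (max_poly_roots P0 roots (enum_uniq _)) _.
apply/leq_sizeP => k lt_k; rewrite coef_sum big1 // => i _.
rewrite coefD !coefZ !coefXn.
have bound e : (e <= 2 * t)%N -> (k == 2 ^ e)%N = false.
  move=> le_e; apply/negbTE; rewrite neq_ltn; apply/orP; right.
  by apply: leq_trans lt_k; rewrite ltnS leq_exp2l.
have := ltn_ord i; rewrite ltnS => le_it.
by rewrite !bound ?mulr0 ?addr0 //; lia.
Qed.

(** Weil's squaring trick: expand the square over the pairs (x + y, y), polarize,
    and sum over y first. *)
Lemma DG_sum_sqr (j : 'I_t.+1) :
  (0 < j)%N -> a j != 0 ->
  (\sum_x chi (DG_exponent x)) ^+ 2 <= 2 ^+ m * 2 ^+ (2 * t).
Proof.
move=> j_gt0 aj0.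
have -> : (\sum_x chi (DG_exponent x)) ^+ 2 =
    \sum_x chi (DG_exponent x) * ((2 ^ m)%:R *+ (radical_poly.[x] == 0)).
  rewrite expr2 {1}mulr_suml.
  transitivity (\sum_y \sum_x chi (DG_exponent y) * chi (DG_exponent (x + y))).
    apply: eq_bigr => y _; rewrite mulr_sumr.
    by rewrite [LHS](reindex_inj (addIr y)).
  rewrite exchange_big; apply: eq_bigr => x _.
  rewrite -(sum_trace_char_lin t) mulr_sumr; apply: eq_bigr => y _.
  rewrite trace_char_DG_exponentD -[RHS]mul1r -(trace_char_sqr (DG_exponent y)); ring.
apply: le_trans (ler_norm _) _; apply: le_trans (ler_norm_sum _ _ _) _.
under eq_bigr => x _ do rewrite normrM normr_trace_char mul1r ger0_norm
  ?mulrn_wge0 ?ler0n // mulrb.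
rewrite -big_mkcond /= sumr_const -[leLHS]mulr_natr natrX ler_wpM2l ?exprn_ge0 //.
by rewrite -natrX ler_nat (card_radical j_gt0 aj0).
Qed.

End QuadraticSum.
End TraceCharacter.

(** * Tight frames *)

Section TightFrames.

Context (R : realType).

Lemma innerE (n : nat) (u v : 'cV[R]_n) :
  inner u v = \sum_i u i 0 * v i 0.
Proof. by rewrite /inner mxE; apply: eq_bigr => i _; rewrite mxE. Qed.

Lemma inner_ge0 (n : nat) (u : 'cV[R]_n) : 0 <= inner u u.
Proof. by rewrite innerE sumr_ge0 // => i _; rewrite -expr2 sqr_ge0. Qed.

Lemma norm2_ge0 (n : nat) (u : 'cV[R]_n) : 0 <= norm2 u.
Proof. exact: sqrtr_ge0. Qed.

Lemma norm2_sqr (n : nat) (u : 'cV[R]_n) : norm2 u ^+ 2 = inner u u.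
Proof. exact: sqr_sqrtr (inner_ge0 u). Qed.

Lemma inner_scale (n : nat) (a b : R) (u v : 'cV[R]_n) :
  inner (a *: u) (b *: v) = a * b * inner u v.
Proof.
by rewrite !innerE mulr_sumr; apply: eq_bigr => i _; rewrite !mxE; ring.
Qed.

Lemma inner_adjoint (n N : nat) (A : 'M[R]_(n, N)) u v :
  inner (A *m u) v = inner u (A^T *m v).
Proof. by rewrite /inner trmx_mul mulmxA. Qed.

Section Gram.

Context (n N : nat) (A : 'M[R]_(n, N)) (c : R).
Hypothesis gramA : A *m A^T = c%:M.

Lemma tight_of_gram : tight A.
Proof.
have rowE i k : inner (row i A)^T (row k A)^T = c *+ (i == k).
  transitivity ((A *m A^T) i k); last by rewrite gramA mxE.
  by rewrite innerE [RHS]mxE; apply: eq_bigr => j _; rewrite !mxE.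
split=> [i k /negPf ik|i k]; first by rewrite rowE ik.
by rewrite /norm2 !rowE !eqxx.
Qed.

Lemma inner_gram (u : 'cV[R]_n) :
  inner (A^T *m u) (A^T *m u) = c * inner u u.
Proof.
rewrite inner_adjoint trmxK mulmxA gramA mul_scalar_mx.
by rewrite -{1}[u]scale1r inner_scale mul1r.
Qed.

(** With w = A^T A v one has <v, w> = |A v|^2 and |w|^2 = c |A v|^2, so that
    |c v - w|^2 = c (c |v|^2 - |A v|^2), and this is nonnegative. *)
Lemma inner_mul_le (v : 'cV[R]_N) :
  0 < c -> inner (A *m v) (A *m v) <= c * inner v v.
Proof.
move=> c_gt0; set w := A^T *m (A *m v).
have expand : inner (c *: v - w) (c *: v - w) =
    c * (c * inner v v) - c * inner v w *+ 2 + inner w w.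
  rewrite !innerE !mulr_sumr -sumrMnl -sumrB -big_split /=.
  by apply: eq_bigr => i _; rewrite !mxE; ring.
have := inner_ge0 (c *: v - w).
rewrite expand /w -inner_adjoint inner_gram.
rewrite (_ : _ + _ = c * (c * inner v v - inner (A *m v) (A *m v))); last by ring.
by rewrite pmulr_rge0 // subr_ge0.
Qed.

(** The bound sqrt c is attained at A^T e / sqrt c for every unit vector e, since
    A^T / sqrt c is an isometry and A maps this vector to sqrt c times e. *)
Lemma spectral_norm_gram :
  (0 < n)%N -> 0 < c -> spectral_norm A ^+ 2 = c.
Proof.
move=> n_gt0 c_gt0; have c_ge0 := ltW c_gt0.
suff -> : spectral_norm A = Num.sqrt c by rewrite sqr_sqrtr.
have ub : ubound [set norm2 (A *m v) | v in [set v : 'cV[R]_N | norm2 v <= 1]]%classic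
    (Num.sqrt c).
  move=> _ [v /= v_le1 <-]; rewrite ler_sqrt //.
  apply: le_trans (inner_mul_le v c_gt0) _.
  by rewrite ler_piMr // -norm2_sqr expr_le1 // norm2_ge0.
have attained : [set norm2 (A *m v) | v in [set v : 'cV[R]_N | norm2 v <= 1]]%classic
    (Num.sqrt c).
  pose e : 'cV[R]_n := delta_mx (Ordinal n_gt0) 0.
  have ee : inner e e = 1.
    rewrite innerE (bigD1 (Ordinal n_gt0)) //= big1 => [|i /negPf i0].
      by rewrite !mxE !eqxx mulr1 addr0.
    by rewrite !mxE i0 mul0r.
  have sc : (Num.sqrt c)^-1 * (Num.sqrt c)^-1 = c^-1.
    by rewrite -invfM -expr2 sqr_sqrtr.
  exists ((Num.sqrt c)^-1 *: (A^T *m e)) => /=.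
    by rewrite /norm2 inner_scale inner_gram ee sc mulr1 mulVf ?sqrtr1 // gt_eqF.
  rewrite -scalemxAr mulmxA gramA mul_scalar_mx /norm2 !inner_scale ee sc.
  by congr Num.sqrt; field; rewrite gt_eqF.
apply/eqP; rewrite eq_le; apply/andP; split.
  by apply: ge_sup => //; exists (Num.sqrt c).
by apply: ub_le_sup => //; exists (Num.sqrt c).
Qed.

Lemma worst_case_coherence_ge (i j : 'I_N) :
  i != j -> `|inner (col i A) (col j A)| <= worst_case_coherence A.
Proof.
move=> ij; rewrite /worst_case_coherence.
exact: (le_bigmax_cond _ (j := (i, j))
  (fun p : 'I_N * 'I_N => `|inner (col p.1 A) (col p.2 A)|)).
Qed.

(** Write phi for column i, a unit vector. The inner products of phi with the
    columns are the entries of A^T phi, whose squared norm is c; after removal of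
    <phi, phi> = 1, each of the N - 1 remaining squares is at most mu^2. *)
Lemma welch_bound (i : 'I_N) :
  unit_norm A -> c - 1 <= N.-1%:R * worst_case_coherence A ^+ 2.
Proof.
move=> unitA.
have normi : inner (col i A) (col i A) = 1 by rewrite -norm2_sqr unitA expr1n.
have <- : \sum_j inner (col i A) (col j A) ^+ 2 = c.
  rewrite -[c]mulr1 -normi -inner_gram [RHS]innerE.
  apply: eq_bigr => j _; rewrite expr2.
  suff -> : inner (col i A) (col j A) = (A^T *m col i A) j 0 by [].
  by rewrite innerE mxE; apply: eq_bigr => k _; rewrite !mxE mulrC.
rewrite (bigD1 i) //= normi expr1n [leLHS]addrC addKr.
have -> : N.-1%:R * worst_case_coherence A ^+ 2 =
    \sum_(j < N | j != i) worst_case_coherence A ^+ 2.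
  by rewrite sumr_const cardC1 card_ord mulr_natl.
apply: ler_sum => j ji; rewrite -real_normK ?num_real //.
have le_mu := worst_case_coherence_ge (i := i) (j := j).
by rewrite lerXn2r ?nnegrE ?(le_trans _ (le_mu _)) ?le_mu // eq_sym.
Qed.

End Gram.
End TightFrames.

(** * The Delsarte-Goethals frame *)

Section DelsarteGoethals.

Context (R : realType) (F : finFieldType) (m t : nat).
Hypotheses (m_gt0 : (0 < m)%N) (cardF : #|F| = (2 ^ m)%N).

Local Notation chi := (trace_char R m).
Local Notation Phi := (DG_frame R F m t).
Local Notation N := #|{ffun 'I_t.+1 -> F}|.

Lemma card_DG_columns : N = (2 ^ (t.+1 * m))%N.
Proof. by rewrite card_ffun card_ord cardF -expnM mulnC. Qed.

Lemma DG_exponent_coefD (a b : {ffun 'I_t.+1 -> F}) (x : F) :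
  DG_exponent (a + b) x = DG_exponent a x + DG_exponent b x.
Proof.
rewrite /DG_exponent ffunE mulrDl addrACA; congr (_ + _).
by rewrite -big_split /=; apply: eq_bigr => i _; rewrite ffunE mulrDl.
Qed.

Lemma DG_frameE r c :
  Phi r c = (Num.sqrt (2 ^+ m))^-1 * chi (DG_exponent (enum_val c) (enum_val r)).
Proof. by rewrite mxE. Qed.

Lemma sqrt_scale_sqr :
  (Num.sqrt (2 ^+ m))^-1 * (Num.sqrt (2 ^+ m))^-1 = (2 ^+ m)^-1 :> R.
Proof. by rewrite -invfM -expr2 sqr_sqrtr // exprn_ge0. Qed.

Lemma DG_inner_col (i j : 'I_N) :
  inner (col i Phi) (col j Phi) =
  (2 ^+ m)^-1 * \sum_x chi (DG_exponent (enum_val i + enum_val j) x).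
Proof.
rewrite innerE (big_enum_val (A := F)) mulr_sumr.
apply: eq_bigr => r _.
rewrite ![col _ _ _ _]mxE !DG_frameE DG_exponent_coefD trace_charD //.
rewrite -sqrt_scale_sqr; ring.
Qed.

(** Orthogonality over the coefficient vectors: if x and y differ, some translation
    of the coordinate a_0 alone changes the product by a factor other than 1. *)
Lemma sum_over_coefficients (x y : F) :
  \sum_(a : {ffun 'I_t.+1 -> F}) chi (DG_exponent a x) * chi (DG_exponent a y)
  = N%:R *+ (x == y).
Proof.
have [->|xy] := eqVneq x y.
  under eq_bigr => a _ do rewrite trace_char_sqr.
  by rewrite sumr_const mulr1n.
have char2 := oppr_pchar2 (pchar2_field cardF).
have xy0 : x + y != 0 by rewrite addr_eq0 char2.
have [z chi_z] := trace_char_mul_neq1 R m_gt0 cardF xy0.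
pose b : {ffun 'I_t.+1 -> F} := [ffun i => if i == ord0 then z else 0].
have expb w : DG_exponent b w = z * w.
  rewrite /DG_exponent ffunE eqxx big1 ?addr0 // => i i_gt0.
  by rewrite ffunE ifN ?mul0r // -val_eqE /= -lt0n.
apply: (sum_shift_eigen0 (h := +%R b)) chi_z; first exact: addrI.
move=> a; rewrite !DG_exponent_coefD !expb [(x + y) * z]mulrC mulrDr.
by rewrite !trace_charD //; ring.
Qed.

Lemma DG_gram : Phi *m Phi^T = (2 ^+ (t * m))%:M.
Proof.
apply/matrixP => r s; rewrite !mxE.
have -> : \sum_j Phi r j * Phi^T j s = (2 ^+ m)^-1 *
    \sum_(a : {ffun 'I_t.+1 -> F})
      chi (DG_exponent a (enum_val r)) * chi (DG_exponent a (enum_val s)).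
  rewrite (big_enum_val (A := {ffun 'I_t.+1 -> F})) mulr_sumr.
  apply: eq_bigr => j _; rewrite [Phi^T _ _]mxE !DG_frameE -sqrt_scale_sqr; ring.
rewrite sum_over_coefficients (inj_eq enum_val_inj) card_DG_columns mulSn.
rewrite natrX exprD mulrnAr mulKf //.
by rewrite expf_neq0 // pnatr_eq0.
Qed.

Lemma DG_unit_norm : unit_norm Phi.
Proof.
move=> j; rewrite /norm2 DG_inner_col.
rewrite (_ : \sum_x _ = 2 ^+ m) ?mulVf ?sqrtr1 ?expf_neq0 ?pnatr_eq0 //.
under eq_bigr => x _ do rewrite DG_exponent_coefD trace_charD // trace_char_sqr.
by rewrite sumr_const cardF natrX.
Qed.

Lemma DG_inner_col_bound (i j : 'I_N) :
  i != j -> inner (col i Phi) (col j Phi) ^+ 2 <= 2 ^+ (2 * t) / 2 ^+ m.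
Proof.
(* In characteristic 2 the sum of the two exponent vectors is their difference. *)
move=> ij; rewrite DG_inner_col; set a := enum_val i + enum_val j.
have bound_ge0 : 0 <= 2 ^+ (2 * t) / 2 ^+ m :> R.
  by rewrite divr_ge0 ?exprn_ge0.
have a_neq0 : a != 0.
  rewrite addr_eq0; apply: contra ij => /eqP ij; apply/eqP/enum_val_inj.
  rewrite ij; apply/ffunP => k.
  by rewrite ffunE (oppr_pchar2 (pchar2_field cardF)).
have [[k k_gt0 ak]|a0] : (exists2 k : 'I_t.+1, (0 < k)%N & a k != 0) \/
    forall k : 'I_t.+1, (0 < k)%N -> a k = 0.
  have [/existsP[k /andP[k_gt0 ak]]|] :=
    boolP [exists k : 'I_t.+1, (0 < k)%N && (a k != 0)]; first by left; exists k.
  rewrite negb_exists => /forallP all0; right=> k k_gt0.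
  by have := all0 k; rewrite k_gt0 negbK => /eqP.
- rewrite exprMn; have := DG_sum_sqr R m_gt0 cardF k_gt0 ak.
  rewrite -(ler_pM2l (x := (2 ^+ m)^-1 ^+ 2)); last first.
    by rewrite exprn_gt0 // invr_gt0 exprn_gt0.
  move/le_trans; apply; rewrite le_eqVlt; apply/orP; left; apply/eqP.
  have : 2 ^+ m != 0 :> R by rewrite expf_neq0 // pnatr_eq0.
  by move: (2 ^+ m) (2 ^+ (2 * t)) => n e n_neq0; field.
rewrite (_ : \sum_x _ = 0) ?mulr0 ?expr0n //.
have a00 : a ord0 != 0.
  apply: contra_neq a_neq0 => a00; apply/ffunP => k; rewrite [RHS]ffunE.
  have [->//|k_neq0] := eqVneq k ord0.
  by apply: a0; rewrite lt0n.
have := sum_trace_char_lin R m_gt0 cardF 0 (a ord0); rewrite (negPf a00) mulr0n => sum0.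
rewrite -[RHS]sum0.
apply: eq_bigr => x _; rewrite /DG_exponent expr1 big1 ?addr0 // => k k_gt0.
by rewrite a0 // mul0r.
Qed.

(** Summing over the columns first, [sum_over_coefficients] with y = 0, whose
    exponent vanishes, shows that only the row x = 0 contributes. *)
Lemma DG_inner_col_sum (i : 'I_N) :
  \sum_(j < N | j != i) inner (col i Phi) (col j Phi) = 2 ^+ (t * m) - 1.
Proof.
have normi : inner (col i Phi) (col i Phi) = 1.
  by rewrite -norm2_sqr DG_unit_norm expr1n.
suff : \sum_j inner (col i Phi) (col j Phi) = 2 ^+ (t * m).
  by rewrite (bigD1 i) //= normi => <-; rewrite [RHS]addrC addKr.
have exp0 (a : {ffun 'I_t.+1 -> F}) : DG_exponent a 0 = 0.
  rewrite /DG_exponent mulr0 add0r big1 // => k _.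
  by rewrite addn1 expr0n mulr0.
under eq_bigr => j _ do rewrite DG_inner_col.
rewrite -mulr_sumr exchange_big /=.
rewrite (bigD1 0) //= [X in _ + X]big1 ?addr0 => [|x x_neq0].
  under eq_bigr => j _ do rewrite exp0 (trace_char0 _ m_gt0 cardF).
  rewrite sumr_const card_ord card_DG_columns mulSn natrX exprD mulKf //.
  by rewrite expf_neq0 // pnatr_eq0.
under eq_bigr => j _ do rewrite DG_exponent_coefD trace_charD //.
rewrite -mulr_sumr.
have := sum_over_coefficients x 0.
under eq_bigr => a _ do rewrite exp0 (trace_char0 _ m_gt0 cardF) mulr1.
by rewrite (negPf x_neq0) (big_enum_val (A := {ffun 'I_t.+1 -> F})) => ->; rewrite mulr0.
Qed.

Lemma DG_worst_case_coherence_le :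
  worst_case_coherence Phi <= (Num.sqrt (2 ^ (m%:Z - 2 * t%:Z - 1)))^-1.
Proof.
apply: bigmax_le => [|[i j] /= ij]; first by rewrite invr_ge0 sqrtr_ge0.
have two0 : 2 != 0 :> R by rewrite pnatr_eq0.
rewrite -sqrtrV ?exprz_ge0 // -sqrtr_sqr ler_sqrt ?invr_ge0 ?exprz_ge0 //.
apply: le_trans (DG_inner_col_bound ij) _.
have -> : 2 ^+ (2 * t) / 2 ^+ m = (2 ^ (m%:Z - 2 * t%:Z) : R)^-1.
  by rewrite invr_expz opprB expfzDr // -invr_expz.
rewrite lef_pV2 ?posrE ?exprz_gt0 //.
by rewrite ler_eXz2l ?ltr1n // gerBl.
Qed.

(** Up to the factor 1 / (N - 1), the sum in the average coherence is the same for
    every column and equals the left-hand side of the Welch bound. *)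
Lemma DG_average_coherence_le :
  average_coherence Phi <= worst_case_coherence Phi / Num.sqrt (2 ^+ m).
Proof.
set mu := worst_case_coherence Phi.
have mu_ge0 : 0 <= mu by exact: bigmax_ge_id.
have bound_ge0 : 0 <= mu / Num.sqrt (2 ^+ m) by rewrite divr_ge0 ?sqrtr_ge0.
apply: bigmax_le => // i _; rewrite DG_inner_col_sum.
have := welch_bound DG_gram i DG_unit_norm; rewrite -/mu.
set c : R := 2 ^+ (t * m); set n : R := 2 ^+ m.
have n_gt1 : 1 < n by rewrite exprn_egt1 ?ltr1n // -lt0n.
have c_ge1 : 1 <= c by rewrite exprn_ege1 // ler1n.
have -> : N.-1%:R = n * c - 1.
  rewrite card_DG_columns -subn1 natrB ?expn_gt0 //.
  by rewrite mulSn natrX exprD.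
set q := _^-1 * _ => welch.
have d_gt0 : 0 < n * c - 1 by nra.
have q_ge0 : 0 <= q by rewrite mulr_ge0 ?subr_ge0 // invr_ge0 ltW.
have q_mu : q <= mu ^+ 2 by rewrite /q mulrC ler_pdivrMr // mulrC.
have q_n : q <= n^-1.
  rewrite /q mulrC ler_pdivrMr // ler_pdivlMl; [nra|lra].
rewrite ger0_norm // -(ler_pXn2r (n := 2)) ?nnegrE //.
rewrite [leRHS]exprMn exprVn sqr_sqrtr; last lra.
by rewrite expr2; apply: ler_pM.
Qed.

End DelsarteGoethals.

Theorem theorem60 (R : realType) (F : finFieldType) (m t : nat)
    (hm : (1 <= m)%N) (ht : (1 <= t)%N) (hF : #|F| = (2 ^ m)%N) :
  let Phi := DG_frame R F m t in
  let mu := worst_case_coherence Phi in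
  let nu := average_coherence Phi in
  [/\ #|{ffun 'I_t.+1 -> F}| = (2 ^ (t.+1 * m))%N,
      unit_norm Phi,
      tight Phi /\ spectral_norm Phi ^+ 2 = 2 ^+ (t * m),
      mu <= (Num.sqrt (2 ^ (m%:Z - 2 * t%:Z - 1)))^-1 &
      nu <= mu / Num.sqrt (2 ^+ m)].
Proof.
move=> Phi mu nu; have gramPhi := DG_gram R t hm hF; split.
- exact: card_DG_columns.
- exact: DG_unit_norm.
- split; first exact: tight_of_gram gramPhi.
  apply: spectral_norm_gram gramPhi _ _; first by rewrite hF expn_gt0.
  by rewrite exprn_gt0.
- exact: DG_worst_case_coherence_le.
- exact: DG_average_coherence_le.
Qed.
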